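(* Let $N>0$ be an even integer and let $m>0$ be an integer. Let $\mu$ be a real number satisfying $$\mu e^{\mu+1}\ge m+2,$$ and let $S=\big\lceil e^{\mu+1}\ln(\pi N)-1\big\rceil$. For each integer $k\neq 0$ with $-N/2\le k\le N/2-1$ and each real $z$ with $0<z\le 2$, let $R_k(z)$ be the remainder of the degree-$S$ Taylor expansion about $z=1$ of the function $g_k(z)=(4\pi^2k^2)^{z/2}$, i.e. $$R_k(z)=(4\pi^2k^2)^{z/2}-\sum_{s=0}^{S}\frac{(4\pi^2k^2)^{1/2}}{\Gamma(s+1)}\,\frac{\ln^s(4\pi^2k^2)}{2^s}\,(z-1)^s .$$ Then $$|R_k(z)|\le N^{-m}\qquad\text{for all integers } k\neq 0 \text{ with } -N/2\le k\le N/2-1 \text{ and all } 0<z\le 2 .$$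
   Context: $\Gamma$ denotes the Gamma function, $\lceil\cdot\rceil$ the ceiling function, $\ln$ the natural logarithm, and $\ln^s(a)=(\ln a)^s$. Equivalently, by Taylor's theorem with Lagrange remainder, $R_k(z)=\frac{(4\pi^2k^2)^{\xi/2}}{\Gamma(S+2)}\frac{\ln^{S+1}(4\pi^2k^2)}{2^{S+1}}(z-1)^{S+1}$ for some $\xi$ between $1$ and $z$. *)

(* Defs.v *)
From HB Require Import structures.
From mathcomp Require Export all_boot all_order all_algebra.
From mathcomp Require Export all_classical all_reals all_analysis.

Set Implicit Arguments.
Unset Strict Implicit.
Unset Printing Implicit Defensive.

Export Order.TTheory GRing.Theory Num.Theory.
Export numFieldNormedType.Exports.

Local Open Scope ring_scope.

(* Euler's integral of the second kind; meaningful for x > 0 only. *)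
Definition Gamma (R : realType) (x : R) : R :=
  \int[lebesgue_measure]_(t in `]0, +oo[) (t `^ (x - 1) * expR (- t)).

(* The absolute value only turns the int given by the ceiling into a nat: the
   ceiling is nonnegative as soon as 0 <= mu and 2 <= N. *)
Definition taylor_degree (R : realType) (mu : R) (N : nat) : nat :=
  `|Num.ceil (expR (mu + 1) * ln (pi * N%:R) - 1)|%N.

Definition taylor_remainder (R : realType) (S : nat) (k : int) (z : R) : R :=
  let a := 4 * pi ^+ 2 * k%:~R ^+ 2 in
  a `^ (z / 2) -
  \sum_(0 <= s < S.+1)
    a `^ (1 / 2) / Gamma (s%:R + 1) * (ln a ^+ s / 2 ^+ s) * (z - 1) ^+ s.

(* Main.v *)
Require Import Defs.
From mathcomp Require Import measurable_realfun ring lra.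

(** Put b = ln (2 pi |k|), so that g_k(z) = e^(bz) = e^b e^w with
    w = b (z - 1), and write n = S + 1.  Since Gamma (s + 1) = s!, the remainder
    R_k(z) is e^b times the tail, from rank n on, of the exponential series
    at w ([taylor_remainderE]).

    Let L = ln (pi N) and c = e^(mu + 1).  The bounds on k and z give
    0 <= b <= L and |w| <= L.  The tail is at most (|w|^n / n!) e^|w|
    ([expR_taylor_bound]), hence |R_k(z)| <= e^(2L) L^n / n!.  The definition
    of S says that n >= c L; as (c L)^n / n! <= e^(c L),

      L^n / n! <= c^(-n) e^(c L) <= e^(- (mu + 1) c L) e^(c L) = e^(- mu c L)

    ([exprn_fact_le_expRN]), with no need of Stirling's formula.  Since
    mu c >= m + 2, the bound becomes e^(2L) e^(- (m + 2) L) = (pi N)^(-m),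
    which is at most N^(-m).

    The value of Gamma at n + 1 ([Gamma_nat]) follows from the fundamental
    theorem of calculus on [0, +oo[, with the primitive
    - n! e^(-t) (1 + t + ... + t^n / n!) of t^n e^(-t). *)

Local Open Scope ring_scope.

Lemma exprn_fact_le_expR (R : realType) (n : nat) (x : R) :
  0 <= x -> x ^+ n / n`!%:R <= expR x.
Proof.
case: n => [|n] x0; last by apply: le_trans (expR_ge1Dxn n x0); rewrite lerDr.
by rewrite expr0 divr1 (le_trans _ (expR_ge1Dx x))// lerDl.
Qed.

Lemma cvg_exprn_expRN (R : realType) (n : nat) :
  (x ^+ n * expR (- x) @[x --> +oo] --> (0 : R))%classic.
Proof.
(* From t^(n+1) / (n+1)! <= e^t one gets t^n e^(-t) <= (n+1)! / t. *)
have cV : (n.+1`!%:R * x^-1 @[x --> +oo] --> (0 : R))%classic.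
  rewrite -(mulr0 n.+1`!%:R); apply: cvgMr.
  by apply/gtr0_cvgV0 => //; near=> x.
apply: squeeze_cvgr (cvg_cst 0) cV; near=> x.
have x0 : 0 < x by [].
have x0' := ltW x0.
rewrite mulr_ge0 ?exprn_ge0 ?expR_ge0//=.
rewrite expRN ler_pdivrMr ?expR_gt0// -mulrA mulrCA ler_pdivlMl//.
have := exprn_fact_le_expR _ n.+1 _ x0'.
by rewrite ler_pdivrMr ?ltr0n ?fact_gt0// exprS mulrC [_ * expR _]mulrC.
Unshelve. all: by end_near.
Qed.

(** [series u n] sums the terms of index less than [n], so [series (exp_coeff t) n.+1]
    is the Taylor polynomial of degree [n], and its derivative is the one of
    degree [n - 1]. *)
Lemma is_derive_series_exp_coeff (R : realType) (n : nat) (x : R) :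
  is_derive x 1 (fun t : R => series (exp_coeff t) n.+1)
    (series (exp_coeff x) n).
Proof.
elim: n => [|n IH].
  rewrite (_ : (fun _ => _) = cst 1); last first.
    by apply/funext => t; rewrite /series/= big_nat1 /exp_coeff/= expr0 divr1.
  by rewrite /series/= big_geq//; exact: is_derive_cst.
rewrite (_ : (fun _ => _) =
    (fun t : R => series (exp_coeff t) n.+1) \+ n.+1`!%:R^-1 *: (id ^+ n.+1 : R -> R));
  last first.
  apply/funext => t; rewrite {1}/series/= big_nat_recr//=; congr (_ + _).
  by rewrite /exp_coeff/= mulrC [in RHS]/GRing.scale/= exprfctE.
have -> : series (exp_coeff x) n.+1 =
    series (exp_coeff x) n + n.+1`!%:R^-1 *: ((n.+1%:R * x ^+ n) *: 1).
  rewrite /series/= big_nat_recr//=; congr (_ + _).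
  rewrite /exp_coeff/= factS natrM /GRing.scale/=; field.
  by rewrite nat1r !pnatr_eq0 -lt0n fact_gt0.
exact: is_deriveD.
Qed.

(** The primitive of t^n e^(-t) that repeated integration by parts produces:
    differentiating its two factors makes all terms but the last telescope. *)
Lemma is_derive_Gamma_primitive (R : realType) (n : nat) (x : R) :
  is_derive x 1
    (fun t : R => - n`!%:R * (series (exp_coeff t) n.+1 * expR (- t)))
    (x ^+ n * expR (- x)).
Proof.
have dS := is_derive_series_exp_coeff _ n x.
have dE : is_derive x 1 (fun t : R => expR (- t)) (expR (- x) * -1).
  exact: (@is_derive1_comp _ expR -%R).
have := is_deriveZ (- n`!%:R) (is_deriveM dS dE).
set d := (X in is_derive _ _ _ X -> _).
suff -> : d = x ^+ n * expR (- x) by [].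
rewrite /d /series/= big_nat_recr//= /exp_coeff/= /GRing.scale/=; field.
by rewrite pnatr_eq0 -lt0n fact_gt0.
Qed.

Lemma cvg_Gamma_primitive (R : realType) (n : nat) :
  (- n`!%:R * (series (exp_coeff t) n.+1 * expR (- t)) @[t --> +oo] -->
     (0 : R))%classic.
Proof.
rewrite -(mulr0 (- n`!%:R : R)); apply: cvgMr.
elim: n => [|n IH].
  apply: cvg_trans (@cvgr_expR R); apply: near_eq_cvg; near=> t.
  by rewrite /series/= big_nat1 /exp_coeff/= expr0 divr1 mul1r.
rewrite (_ : (fun _ => _) = fun t : R =>
    series (exp_coeff t) n.+1 * expR (- t)
      + n.+1`!%:R^-1 * (t ^+ n.+1 * expR (- t))); last first.
  apply/funext => t; rewrite {1}/series/= big_nat_recr//= mulrDl; congr (_ + _).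
  by rewrite /exp_coeff/= mulrAC mulrC.
rewrite -[X in (_ --> X)%classic](addr0 0); apply: cvgD => //.
by rewrite -[X in (_ --> X)%classic](mulr0 n.+1`!%:R^-1); apply: cvgMr;
  exact: cvg_exprn_expRN.
Unshelve. all: by end_near.
Qed.

Lemma Gamma_nat (R : realType) (n : nat) : Gamma (n%:R + 1) = n`!%:R :> R.
Proof.
pose f (t : R) := t ^+ n * expR (- t).
have cf : continuous f.
  move=> t; apply: cvgM; first exact: exprn_continuous.
  by apply: continuous_comp; [exact: opp_continuous|exact: continuous_expR].
pose F (t : R) := - n`!%:R * (series (exp_coeff t) n.+1 * expR (- t)).
have dF (x : R) : is_derive x 1 F (f x) := is_derive_Gamma_primitive _ n x.
have cF : continuous F.
  by move=> x; apply: differentiable_continuous; apply/derivable1_diffP; case: (dF x).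
have -> : Gamma (n%:R + 1) =
    (\int[lebesgue_measure]_(t in `]0%R, +oo[) f t)%R.
  apply: eq_Rintegral => t; rewrite inE/= in_itv/= andbT => t0.
  by rewrite addrK powR_mulrn// ltW.
(* The singleton {0} is negligible, so the interval may be closed at 0. *)
rewrite /Rintegral integral_itv_obnd_cbnd//; last first.
  apply/measurable_EFinP; apply: measurable_funTS.
  exact: continuous_measurable_fun.
rewrite (@ge0_continuous_FTC2y _ f F 0 0) /=.
- rewrite /F oppr0 expR0 mulr1 series_exp_coeff0 mulr1 opprK add0r//.
- by move=> x x0; rewrite mulr_ge0 ?exprn_ge0 ?expR_ge0.
- exact: continuous_subspaceT.
- exact: cvg_Gamma_primitive.
- by move=> x _; case: (dF x).
- exact: cvg_at_right_filter (cF 0).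
- by move=> x _; rewrite derive1E; case: (dF x).
Qed.

Lemma series_exp_coeff_le_expR (R : realType) (n : nat) (x : R) :
  0 <= x -> series (exp_coeff x) n <= expR x.
Proof.
move=> x0; apply: nondecreasing_cvgn_le; last exact: is_cvg_series_exp_coeff.
by apply: nondecreasing_series => i _ _; exact: exp_coeff_ge0.
Qed.

(** A Lagrange-type bound obtained from the series itself:
    1 / (n + i)! <= 1 / (n! i!) dominates the tail by the series of e^|x|. *)
Lemma expR_taylor_bound (R : realType) (n : nat) (x : R) :
  `|expR x - series (exp_coeff x) n| <= `|x| ^+ n / n`!%:R * expR `|x|.
Proof.
have cv : (`|series (exp_coeff x) (M + n)%N - series (exp_coeff x) n|
    @[M --> \oo] --> `|expR x - series (exp_coeff x) n|)%classic.
  apply: cvg_norm; apply: cvgB; last exact: cvg_cst.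
  have := @is_cvg_series_exp_coeff R x.
  by rewrite -(cvg_shiftn n).
apply: (cvgr_to_le cv); near=> M.
rewrite /series/= (@big_cat_nat _ _ _ n 0 (M + n))//= ?leq_addl// addrAC subrr add0r.
rewrite -{1}(add0n n) big_addn addnK.
apply: le_trans (ler_norm_sum _ _ _) _.
have x0 := normr_ge0 x.
apply: (@le_trans _ _ (`|x| ^+ n / n`!%:R * series (exp_coeff `|x|) M)); last first.
  by rewrite ler_wpM2l ?series_exp_coeff_le_expR// divr_ge0 ?exprn_ge0.
rewrite /series/= mulr_sumr; apply: ler_sum => i _.
rewrite /exp_coeff/= normrM normfV normrX normr_nat exprD.
rewrite mulrACA -invfM [`|x| ^+ i * _]mulrC ler_wpM2l ?mulr_ge0 ?exprn_ge0//.
rewrite lef_pV2 ?posrE -?natrM ?ltr0n ?muln_gt0 ?fact_gt0// ler_nat.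
have := @bin_fact (i + n) n (leq_addl _ _); rewrite addnK => <-.
by rewrite leq_pmull// bin_gt0 leq_addl.
Unshelve. all: by end_near.
Qed.

(** The choice of the Taylor degree enters here: [n] terms, with [n] at least
    e^(mu + 1) L, make L^n / n! exponentially small in L. *)
Lemma exprn_fact_le_expRN (R : realType) (n : nat) (mu L : R) :
  0 <= mu -> 0 <= L -> expR (mu + 1) * L <= n%:R ->
  L ^+ n / n`!%:R <= expR (- (mu * expR (mu + 1) * L)).
Proof.
set c := expR (mu + 1) => mu0 L0 hn.
have c0 : 0 < c := expR_gt0 _.
(* Apply x^n / n! <= e^x at x = c L and divide by c^n = e^(n (mu + 1)). *)
have := exprn_fact_le_expR _ n _ (mulr_ge0 (ltW c0) L0).
have cn : c ^+ n = expR (n%:R * (mu + 1)) by rewrite expRM_natl.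
rewrite exprMn -(mulrA (c ^+ n)) -ler_pdivlMl ?exprn_gt0// => /le_trans; apply.
rewrite cn -expRN -expRD ler_expR.
have : (mu + 1) * (c * L) <= (mu + 1) * n%:R by rewrite ler_wpM2l// addr_ge0.
lra.
Qed.

(** With b = ln (2 pi |k|), the base 4 pi^2 k^2 is e^(2b): the remainder is e^b
    times an exponential remainder at b (z - 1). *)
Lemma taylor_remainderE (R : realType) (S : nat) (k : int) (z : R) :
  k != 0 -> let b := ln (2 * pi * `|k%:~R : R|) in
  taylor_remainder S k z =
    expR b * (expR (b * (z - 1)) - series (exp_coeff (b * (z - 1))) S.+1).
Proof.
move=> k0 b; rewrite /taylor_remainder.
have p0 : 0 < 2 * pi * `|k%:~R : R|.
  by rewrite !mulr_gt0 ?pi_gt0// normr_gt0 intr_eq0.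
have -> : 4 * pi ^+ 2 * k%:~R ^+ 2 = (2 * pi * `|k%:~R|) ^+ 2 :> R.
  by rewrite !exprMn real_normK ?num_real//; ring.
set a := _ ^+ 2.
have lna : ln a = 2 * b by rewrite /a lnXn// -[LHS]mulr_natl.
have powa y : a `^ (y / 2) = expR (b * y).
  by rewrite /powR gt_eqF ?exprn_gt0// lna; congr expR; field.
rewrite !powa mulr1 mulrBr -expRD; congr (expR _ - _); first ring.
rewrite /series/= mulr_sumr; apply: eq_bigr => s _.
rewrite Gamma_nat lna /exp_coeff/= !exprMn; field.
by rewrite -natrX !pnatr_eq0 -!lt0n fact_gt0 expn_gt0.
Qed.

Theorem theorem3p1 (R : realType) (N m : nat) (mu : R)
    (hN0 : (0 < N)%N) (hNeven : ~~ odd N) (hm : (0 < m)%N)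
    (hmu : mu * expR (mu + 1) >= m%:R + 2) :
  forall (k : int) (z : R),
    k != 0 -> - (N%:R / 2) <= k%:~R :> R -> k%:~R <= N%:R / 2 - 1 :> R ->
    0 < z -> z <= 2 ->
    `|taylor_remainder (taylor_degree mu N) k z| <= N%:R ^- m.
Proof.
move=> k z k0 Nk kN z0 z2.
have mu0 : 0 <= mu.
  have := lt_le_trans (_ : 0 < m%:R + 2) hmu.
  by rewrite ltr_wpDl// => /(_ isT); rewrite pmulr_lgt0 ?expR_gt0// => /ltW.
(* A nonzero integer has absolute value at least 1; this makes b nonnegative. *)
have k1 : 1 <= `|k%:~R : R| by rewrite -intr_norm ler1z -gtz0_ge1 normr_gt0.
have kN2 : `|k%:~R : R| <= N%:R / 2 by rewrite ler_norml Nk/=; lra.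
have pi2 := pi_ge2 R.
have x1 : 1 <= 2 * pi * `|k%:~R : R|.
  by rewrite (le_trans _ (ler_peMr _ k1))//; lra.
have xN : 2 * pi * `|k%:~R : R| <= pi * N%:R.
  have : pi * `|k%:~R| <= pi * (N%:R / 2) :> R by rewrite ler_wpM2l// pi_ge0.
  lra.
have N0 : 0 < N%:R :> R by rewrite ltr0n.
have piN0 : 0 < pi * N%:R :> R by rewrite mulr_gt0 ?pi_gt0.
rewrite taylor_remainderE//; set b := ln _; set w := b * _.
pose L : R := ln (pi * N%:R).
have bL : b <= L by rewrite ler_ln// posrE (lt_le_trans ltr01).
have b0 : 0 <= b by exact: ln_ge0.
have wL : `|w| <= L.
  rewrite normrM (ger0_norm b0) (le_trans _ bL)// ler_piMr//.
  rewrite ler_norml; lra.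
have L0 : 0 <= L := le_trans b0 bL.
set n := (taylor_degree mu N).+1.
have hn : expR (mu + 1) * L <= n%:R.
  rewrite /n -natr1 -lerBlDr (le_trans (ceil_ge _))//.
  by rewrite /taylor_degree pmulrn ler_int abszE ler_norm.
rewrite normrM (ger0_norm (expR_ge0 _)).
have Lm : expR (- (m%:R * L)) <= N%:R ^- m.
  rewrite expRN expRM_natl lnK ?posrE// lef_pV2 ?posrE ?exprn_gt0//.
  have N0' := ltW N0; have piN0' := ltW piN0.
  by rewrite lerXn2r// ler_peMl//; lra.
apply: le_trans Lm.
(* The two factors e^L absorb e^b and the factor e^|w| of the tail bound. *)
have -> : expR (- (m%:R * L)) = expR L * (expR (- ((m%:R + 2) * L)) * expR L).
  by rewrite -!expRD; congr expR; ring.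
rewrite ler_pM ?expR_ge0 ?ler_expR//.
apply: le_trans (expR_taylor_bound _ n w) _.
rewrite ler_pM ?expR_ge0 ?ler_expR ?divr_ge0 ?exprn_ge0//.
apply: (@le_trans _ _ (L ^+ n / n`!%:R)).
  by rewrite ler_wpM2r ?invr_ge0// lerXn2r.
apply: le_trans (exprn_fact_le_expRN _ _ _ _ mu0 L0 hn) _.
by rewrite ler_expR lerN2 ler_wpM2r.
Qed.
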